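(* A regular Hausdorff space $X$ has a $W_\delta$-diagonal if and only if $\mathcal{F}(X)$ has a $W_\delta$-diagonal.
   Context: $\mathcal{F}(X)$ is the set of nonempty finite subsets of $X$ with the Vietoris topology (base: $\langle U_1,\dots,U_k\rangle=\{A: A\subset\bigcup_i U_i,\ A\cap U_j\neq\emptyset\ \forall j\}$, $U_i$ open in $X$). A space $Y$ has a $W_\delta$-diagonal if there is a sequence $\{\mathcal{B}_n\}$ of bases of $Y$ such that whenever $x\in b_n\in\mathcal{B}_n$ for all $n$ and $\{b_n\}$ is decreasing, $\bigcap_n b_n=\{x\}$. *)

(* Defs.v *)
From mathcomp Require Import all_boot all_order.
From mathcomp Require Import all_classical all_reals all_analysis.
Set Implicit Arguments. Unset Strict Implicit. Unset Printing Implicit Defensive.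
Local Open Scope classical_set_scope.

Definition is_base_of (T : Type) (opens : set (set T)) (B : set (set T)) :=
  B `<=` opens /\
  forall (W : set T) (x : T), opens W -> W x ->
    exists b, B b /\ b x /\ b `<=` W.

Definition Wdelta_diagonal (T : Type) (opens : set (set T)) :=
  exists Bs : nat -> set (set T),
    (forall n, is_base_of opens (Bs n)) /\
    forall (x : T) (b : nat -> set T),
      (forall n, Bs n (b n)) -> (forall n, b n x) ->
      (forall n, b n.+1 `<=` b n) ->
      \bigcap_n b n = [set x].

Definition finsub (X : Type) := {A : set X | finite_set A /\ A !=set0}.

Definition vietoris_box (X : Type) (s : seq (set X)) : set (finsub X) :=
  [set A | proj1_sig A `<=` \bigcup_(U in [set U | U \in s]) U /\
           (forall U, U \in s -> proj1_sig A `&` U !=set0)].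

Definition vietoris_base (X : topologicalType) : set (set (finsub X)) :=
  [set W | exists s : seq (set X),
     s != [::] /\ (forall U, U \in s -> open U) /\ W = vietoris_box s].

Arguments vietoris_base : clear implicits.
Definition vietoris_open (X : topologicalType) : set (set (finsub X)) :=
  [set W | forall A, W A -> exists2 b, vietoris_base X b & b A /\ b `<=` W].
Arguments vietoris_open : clear implicits.

(* Main.v *)
(** A W_delta-diagonal is equivalent to a sieve: a tree of open sets in which
    every node is covered by its children and every branch has at most one
    common point.  From bases [B_n] one takes all decreasing finite sequences
    [b_0, ..., b_n] with [b_i] in [B_i].  Conversely, well-order the nodes and
    let every point follow its branch of successively least nodes; call [c] an
    [n]-th basic set when it lies in the [n]-th node of the branch of one of its
    points.  Along a decreasing sequence of such sets these branches stabilise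
    level by level, so that the intersection lies inside a single branch.

    Sieves pull back along injections with open preimages, in particular along
    [x |-> {x}] from [X] to [F(X)].  For the other direction, the nodes of level
    [n] over [F(X)] are the finite families of pairwise disjoint members of
    [B_n], refining one another.  If finite sets [A] and [B] lie on a common
    branch and [a] is in [A], then the members containing [a] decrease by
    disjointness, all of them meet the finite set [B], and hence some [b] in [B]
    lies in all of them, so that [b = a]. *)
Require Import Defs.
From mathcomp Require Import all_boot all_order.
From mathcomp Require Import all_classical all_reals all_analysis.
From mathcomp Require Import wochoice.
Set Implicit Arguments. Unset Strict Implicit. Unset Printing Implicit Defensive.
Local Open Scope classical_set_scope.

(** * Well-orders on arbitrary types *)

Lemma well_order_exists (T : Type) : exists R : T -> T -> Prop,
  (forall x y, R x y -> R y x -> x = y) /\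
  (forall P : set T, P !=set0 -> exists2 x, P x & forall y, P y -> R x y).
Proof.
have [R Rwo] := well_ordering_principle {classic T}.
exists (fun x y => R x y); split=> [x y Rxy Ryx|P [p Pp]].
  have refl (z : {classic T}) : R z z.
    have [|m [[/eqP mz lm] _]] := Rwo (pred1 z); first by exists z; apply/eqP.
    by rewrite -{1}mz; apply: lm; apply/eqP.
  (* Both [x] and [y] are least in the pair they form, and least elements are unique. *)
  have [|m [_ um]] := Rwo (pred2 (x : {classic T}) (y : {classic T})).
    by exists x; apply/pred2P; left.
  transitivity (m : T); first (symmetry; apply: um); last apply: um.
    by split=> [|z /pred2P[]->//]; apply/pred2P; left.
  by split=> [|z /pred2P[]->//]; apply/pred2P; right.
have [|m [[Pm lm] _]] := Rwo (fun x : {classic T} => `[< P x >]).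
  by exists p; apply/asboolP.
by exists m; [apply/asboolP | move=> y Py; apply: lm; apply/asboolP].
Qed.

(** * Sieves and W_delta-diagonals *)

Definition has_sieve (T : Type) (opens : set (set T)) :=
  exists (N : Type) (r : N) (child : N -> N -> Prop) (V : N -> set T),
  [/\ V r = setT,
      forall p, opens (V p),
      forall p q, child p q -> V q `<=` V p,
      forall p x, V p x -> exists2 q, child p q & V q x &
      forall (f : nat -> N) x y, f 0 = r -> (forall n, child (f n) (f n.+1)) ->
        (forall n, V (f n) x) -> (forall n, V (f n) y) -> x = y].

Lemma nonincr_subset (T : Type) (b : nat -> set T) :
  (forall n, b n.+1 `<=` b n) -> forall m n, m <= n -> b n `<=` b m.
Proof.
move=> bS m n /subnK <-; elim: (n - m)%N => [//|k IH].
by rewrite addSn; apply: subset_trans (bS _) IH.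
Qed.

Lemma Wdelta_of_sieve (T : Type) (opens : set (set T)) :
  setI_closed opens -> has_sieve opens -> Wdelta_diagonal opens.
Proof.
move=> openI [N [r [child [V [Vr Vo Vmon Vcov Vsep]]]]].
have [R [Ranti Rmin]] := well_order_exists N.
have /choice[mn mnP] : forall P : set N, exists m,
    P !=set0 -> P m /\ forall y, P y -> R m y.
  move=> P; have [/Rmin[m Pm mP]|P0] := pselect (P !=set0); first by exists m.
  by exists r.
(* [t x] is the branch of least nodes followed by [x]. *)
pose t x := fix t n :=
  if n is n'.+1 then mn [set q | child (t n') q /\ V q x] else r.
have tV x n : V (t x n) x.
  elim: n => [|n IH] /=; first by rewrite Vr.
  have [|[]//] := mnP [set q | child (t x n) q /\ V q x].
  by have [q ? ?] := Vcov _ _ IH; exists q.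
have tS x n : child (t x n) (t x n.+1) /\
    forall q, child (t x n) q -> V q x -> R (t x n.+1) q.
  have [|[? _] tmin] := mnP [set q | child (t x n) q /\ V q x].
    by have [q ? ?] := Vcov _ _ (tV x n); exists q.
  by split=> // q ? ?; apply: tmin.
have tmon x m n : m <= n -> V (t x n) `<=` V (t x m).
  by apply: (nonincr_subset (b := fun n => V (t x n))) => {}n; apply: Vmon (tS x n).1.
exists (fun n => [set c | opens c /\ exists2 x, c x & c `<=` V (t x n)]).
split=> [n|x b bC bx bS].
  split=> [c []//|W x Wo Wx].
  exists (W `&` V (t x n)); split; last by split=> [|y []].
  split; first exact: openI.
  by exists x => // y [].
have /choice[y yP] n : exists x, b n x /\ b n `<=` V (t x n).
  by have [_ [z ? ?]] := bC n; exists z.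
have yV m n k : k <= n -> n <= m -> V (t (y n) k) (y m).
  move=> kn nm; apply: (tmon _ _ _ kn); apply: (yP n).2.
  exact: (nonincr_subset bS nm) (yP m).1.
(* Once level [k] has settled at [p], let [q] be the least node taken at level [k.+1] from [m1] on.
   Later points lie in [q], a child of [p], so they choose a node at most [q], hence [q] itself. *)
have /choice[g gP] k : exists p, exists m0, forall m, m0 <= m -> t (y m) k = p.
  elim: k => [|k [p [m0 m0P]]]; first by exists r, 0.
  pose m1 := maxn m0 k.+1.
  have [|q [m2 m12 tq] qmin] := Rmin [set q | exists2 m, m1 <= m & t (y m) k.+1 = q].
    by exists (t (y m1) k.+1), m1.
  exists q, m2 => m m2m.
  have m1m := leq_trans m12 m2m.
  apply: Ranti; last by apply: qmin; exists m.
  move: m12 m1m; rewrite !geq_max => /andP[m02 k2] /andP[m0m km].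
  apply: (tS (y m) k).2; rewrite -tq; last exact: yV.
  by rewrite (m0P m)// -(m0P m2)//; apply: (tS _ _).1.
(* With [k <= m], the set [b m] lies in [V (g k)]. *)
have gm k : exists m, k <= m /\ forall n, m <= n -> t (y n) k = g k.
  have [m mP] := gP k; exists (maxn k m); rewrite leq_maxl; split=> // n.
  by rewrite geq_max => /andP[_ /mP].
have bg k z : (forall n, b n z) -> V (g k) z.
  move=> bz; have [m [km mP]] := gm k.
  by rewrite -(mP m (leqnn m)); apply: (tmon _ _ _ km); apply: (yP m).2.
apply/seteqP; split=> [z bz|_ -> n _]; last exact: bx.
apply: (Vsep g) => [|n|n|n].
- by have [m [_ mP]] := gm 0; rewrite -(mP m).
- have [m [_ mP]] := gm n; have [m' [_ m'P]] := gm n.+1.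
  rewrite -(mP (maxn m m')) ?leq_maxl// -(m'P (maxn m m')) ?leq_maxr//.
  exact: (tS _ _).1.
- by apply: bg => k; apply: bz.
- exact: bg.
Qed.

(** A node keeps only the length and the last set of a decreasing sequence; the branch recovers the
    rest. The root is the whole space, so members of [Bs n] sit at level [n.+1]. *)
Lemma sieve_of_Wdelta (T : Type) (opens : set (set T)) :
  opens setT -> Wdelta_diagonal opens -> has_sieve opens.
Proof.
move=> openT [Bs [Bbase Bsep]].
exists {p : nat * set T | opens p.2}, (exist _ (0, setT) openT).
exists (fun p q => [/\ (sval q).1 = (sval p).1.+1, Bs (sval p).1 (sval q).2 &
  (sval q).2 `<=` (sval p).2]), (fun p => (sval p).2).
split=> //.
- by case.
- by move=> p q [].
- move=> [[n U] /= Uo] x Ux.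
  have [b [Bb [bx bU]]] := (Bbase n).2 _ _ Uo Ux.
  by exists (exist _ (n.+1, b) ((Bbase n).1 _ Bb)).
- move=> f x y f0 fS fx fy.
  have f1 n : (sval (f n)).1 = n.
    by elim: n => [|n IH]; rewrite ?f0//; have [-> _ _] := fS n; rewrite IH.
  suff capy : \bigcap_n (sval (f n.+1)).2 = [set y].
    by have : (\bigcap_n (sval (f n.+1)).2) x; [move=> n _; apply: fx | rewrite capy].
  apply: Bsep => // n; last by have [] := fS n.+1.
  by have [_] := fS n; rewrite f1.
Qed.

Lemma has_sieve_preimage (S T : Type) (opensS : set (set S)) (opensT : set (set T))
    (h : S -> T) :
  injective h -> (forall U, opensT U -> opensS (h @^-1` U)) ->
  has_sieve opensT -> has_sieve opensS.
Proof.
move=> hinj hcont [N [r [child [V [Vr Vo Vmon Vcov Vsep]]]]].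
exists N, r, child, (fun p => h @^-1` V p); split=> [|p|p q pq x|p x|f x y f0 fS fx fy].
- by rewrite Vr.
- exact: hcont.
- exact: Vmon pq _.
- exact: Vcov.
- by apply: hinj; apply: Vsep f0 fS fx fy.
Qed.

(** * Finite sets *)

Lemma finsub_eq (X : Type) (A B : finsub X) : sval A = sval B -> A = B.
Proof.
case: A B => [A hA] [B hB] /= AB.
by subst B; rewrite (Prop_irrelevance hA hB).
Qed.

(** If each [b] in [B] left the sequence at a stage [k b], then [U] would miss [B] at the largest of
    these stages. *)
Lemma finite_nonincr_meets (T : Type) (B : set T) (U : nat -> set T) :
  finite_set B -> (forall n, U n.+1 `<=` U n) ->
  (forall n, B `&` U n !=set0) -> exists2 b, B b & forall n, U n b.
Proof.
move=> /(@finite_seqP {classic T})[l Bl] US BU; apply: contrapT => noB.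
have /choice[k kP] (b : T) : exists n, B b -> ~ U n b.
  apply: contrapT => /forallNP kb; apply: noB.
  have BUb n : B b /\ U n b by have /not_implyP[? /contrapT] := kb n.
  by exists b => [|n]; [have [] := BUb 0 | have [] := BUb n].
have [b [Bb Ub]] := BU (\max_(b <- (l : seq {classic T})) k b).
apply: (kP b Bb); apply: (nonincr_subset US) Ub.
by move: Bb; rewrite Bl => /= bl; apply: leq_bigmax_seq.
Qed.

(** * The Vietoris topology *)

Section Vietoris.
Variable X : topologicalType.
Implicit Types (A : finsub X) (U : set X) (s : seq (set X)).

Lemma vietoris_box_open s :
  (forall U, U \in s -> open U) -> vietoris_open X (vietoris_box s).
Proof.
move=> so A As; exists (vietoris_box s); last by split=> // B.
exists s; split; last by split.
(* A point of [A] has to be covered, so [s] is not empty. *)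
have [_ [a Aa]] := svalP A; have [/(_ a Aa)[U + _] _] := As.
by case: s {so As}.
Qed.

Lemma vietoris_boxT : vietoris_box [:: setT] = setT :> set (finsub X).
Proof.
apply/seteqP; split=> // A _; split=> [x _|U].
  by exists setT => //=; rewrite mem_seq1.
by rewrite mem_seq1 => /eqP ->; rewrite setIT; have [] := svalP A.
Qed.

Lemma vietoris_openT : vietoris_open X setT.
Proof.
rewrite -vietoris_boxT; apply: vietoris_box_open => U.
by rewrite mem_seq1 => /eqP ->; apply: openT.
Qed.

Lemma vietoris_openI : setI_closed (vietoris_open X).
Proof.
move=> W1 W2 W1o W2o A [/W1o[_ [s1 [_ [s1o ->]]] [[A1 m1] s1W]]].
move=> /W2o[_ [s2 [_ [s2o ->]]] [[A2 m2] s2W]].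
(* Only intersections meeting [A] are kept. Each [U] in [s1] still contributes one: a point of [A]
   in [U] lies in some member of [s2]; likewise for [s2]. *)
pose s := [seq p <- [seq U `&` V | U <- s1, V <- s2] | `[< sval A `&` p !=set0 >]].
have sE (p : set X) : p \in s <-> sval A `&` p !=set0 /\
    exists U V, [/\ U \in s1, V \in s2 & p = U `&` V].
  rewrite mem_filter; split=> [/andP[/asboolP Ap /allpairsP[[U V] /= []]]|].
    by split=> //; exists U, V.
  case=> Ap [U [V [Us Vs pE]]]; rewrite asboolT//=.
  by apply/allpairsP; exists (U, V).
have so p : p \in s -> open p.
  by move=> /sE[_ [U [V [/s1o ? /s2o ? ->]]]]; apply: openI.
have As : vietoris_box s A.
  split=> [x Ax|p /sE[]//].
  have [[U Us Ux] [V Vs Vx]] := (A1 _ Ax, A2 _ Ax).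
  exists (U `&` V) => //=; apply/sE; split; first by exists x.
  by exists U, V.
have [b ? [? bs]] := vietoris_box_open so As.
exists b => //; split=> // A' /bs[A's mA']; split.
- apply: s1W; split=> [x /A's[p /sE[_ [U [V [Us _ ->]]]] []]|U Us]; first by exists U.
  have [a [Aa Ua]] := m1 _ Us; have [V Vs Va] := A2 _ Aa.
  have [|a' [A'a' []]] := mA' (U `&` V); last by exists a'.
  by apply/sE; split; [exists a | exists U, V].
- apply: s2W; split=> [x /A's[p /sE[_ [U [V [_ Vs ->]]]] []]|V Vs]; first by exists V.
  have [a [Aa Va]] := m2 _ Vs; have [U Us Ua] := A1 _ Aa.
  have [|a' [A'a' []]] := mA' (U `&` V); last by exists a'.
  by apply/sE; split; [exists a | exists U, V].
Qed.

Definition finsub1 (x : X) : finsub X :=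
  exist _ [set x] (conj (finite_set1 x) (ex_intro _ x erefl)).

Lemma finsub1_inj : injective finsub1.
Proof. by move=> x y /(congr1 sval) /= /seteqP[/(_ x erefl)]. Qed.

Lemma finsub1_preimage_open W : vietoris_open X W -> open (finsub1 @^-1` W).
Proof.
move=> Wo; rewrite openE => x /Wo[_ [s [_ [so ->]]] [[sx xs] sW]].
have [U0 /= U0s _] := sx x erefl.
have : nbhs x (\bigcap_(U in [set` s]) U).
  rewrite bigcap_seq big_seq; elim/big_rec: _ => [|U V Us xV]; first exact: filterT.
  apply: filterI => //; apply: open_nbhs_nbhs; split; first exact: so.
  by have [_ [/= ->]] := xs _ Us.
apply: filterS => y ys; apply: sW; split=> [_ ->|U Us]; first by exists U0 => //; apply: ys.
by exists y; split=> //; apply: ys.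
Qed.

Lemma finite_separation (A : set X) : hausdorff_space X -> finite_set A ->
  exists D : X -> set X, (forall a, open (D a) /\ D a a) /\
    forall a b, A a -> A b -> a <> b -> D a `&` D b = set0.
Proof.
move=> hX /finite_seqP[l Al].
have /choice[S SP] (p : X * X) : exists P : set X * set X,
    [/\ open P.1, open P.2, P.1 p.1, P.2 p.2 & (p.1 <> p.2 -> P.1 `&` P.2 = set0)].
  have [pE|/eqP pE] := pselect (p.1 = p.2).
    by exists (setT, setT); split=> //; apply: openT.
  move: hX; rewrite open_hausdorff => /(_ _ _ pE)[P [/set_mem ? /set_mem ?]].
  by move=> [? ? /eqP ?]; exists P.
(* [S] need not be symmetric, so both orders enter; then [S (a, b)] alone separates [D a] from
   [D b]. *)
exists (fun a => \bigcap_(b in A) ((S (a, b)).1 `&` (S (b, a)).2)).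
split=> [a|a b Aa Ab ab].
  split; last by move=> b _; have [_ _ ? _ _] := SP (a, b); have [_ _ _ ? _] := SP (b, a).
  rewrite Al bigcap_seq; elim/big_rec: _ => [|b V _ Vo]; first exact: openT.
  apply: openI => //; apply: openI; first by have [] := SP (a, b).
  by have [] := SP (b, a).
apply/seteqP; split=> // x [/(_ _ Ab)[xa _] /(_ _ Aa)[_ xb]].
by have [_ _ _ _ /(_ ab) <-] := SP (a, b).
Qed.

(** * A sieve over the finite subsets *)

Let disjoint_family s :=
  forall U V x, U \in s -> V \in s -> U x -> V x -> U = V.

Lemma vietoris_sieve : hausdorff_space X ->
  Wdelta_diagonal (@open X) -> has_sieve (vietoris_open X).
Proof.
move=> hX [Bs [Bbase Bsep]].
(* A list that is not an open disjoint family gets the empty set, so all lists may serve as nodes.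
   Refinement alone would not make [V] decrease, as a member of the old family could be missed;
   [child] therefore demands it. *)
pose V (p : nat * seq (set X)) := [set A | [/\ forall U, U \in p.2 -> open U,
  disjoint_family p.2 & vietoris_box p.2 A]].
exists (nat * seq (set X))%type, (0, [:: setT]), (fun p q => [/\ q.1 = p.1.+1,
  forall U, U \in q.2 -> Bs p.1 U /\ exists2 U', U' \in p.2 & U `<=` U' &
  V q `<=` V p]), V.
split=> //.
- apply/seteqP; split=> // A _; split=> [U|U U' x|]; last by rewrite vietoris_boxT.
  + by rewrite mem_seq1 => /eqP ->; apply: openT.
  + by rewrite !mem_seq1 => /eqP -> /eqP ->.
- move=> p A [po pd pA].
  have [b ? [? bp]] := vietoris_box_open po pA.
  by exists b => //; split=> // A' /bp.
- by move=> p q [].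
- move=> [n s] A [/= so sd [As sA]].
  have [Afin _] := svalP A.
  have [D [Dn Dd]] := finite_separation hX Afin.
  (* Shrinking into [D a] yields disjointness, shrinking into [U] yields refinement. *)
  have /choice[G GP] a : exists G, sval A a ->
      [/\ Bs n G, G a, G `<=` D a & exists2 U, U \in s & G `<=` U].
    have [Aa|] := pselect (sval A a); last by exists setT.
    have [U Us Ua] := As _ Aa; have [Do Da] := Dn a.
    have [G [BG [Ga GU]]] := (Bbase n).2 (D a `&` U) a (openI Do (so _ Us)) (conj Da Ua).
    by exists G => _; split=> // [x /GU[]//|]; exists U => // x /GU[].
  have [l Al] := (finite_seqP _).1 Afin.
  have lA a : a \in l -> sval A a by rewrite Al.
  have s'd : disjoint_family (map G l).
    move=> U U' x /mapP[a /lA Aa ->] /mapP[b /lA Ab ->] Gx G'x.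
    have [->//|ab] := pselect (a = b).
    have [_ _ /(_ _ Gx) ? _] := GP _ Aa; have [_ _ /(_ _ G'x) ? _] := GP _ Ab.
    by have : set0 x by rewrite -(Dd a b Aa Ab ab).
  exists (n.+1, map G l).
    split=> //= [_ /mapP[a /lA/GP[? _ _ ?] ->]//|A' [/= _ _ [A's sA']]].
    split=> //=; split=> [x /A's[_ /= /mapP[a /lA/GP[_ _ _ [U Us GU]] ->] /GU]|U Us].
      by exists U.
    have [a [Aa Ua]] := sA _ Us.
    have [_ Ga _ [U' U's GU']] := GP _ Aa.
    (* Both contain [a], so disjointness of [s] puts [G a] inside the given [U]. *)
    have <- : U' = U by apply: (sd _ _ a) => //; apply: GU'.
    have [|x [A'x Gx]] := sA' (G a); last by exists x; split=> //; apply: GU'.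
    by apply: map_f; move: Aa; rewrite Al.
  split=> //= [_ /mapP[a /lA/GP[BG _ _ _] ->]|]; first exact: (Bbase n).1.
  split=> [a Aa|_ /mapP[a /lA Aa ->]]; last by exists a; have [] := GP _ Aa.
  exists (G a); last by have [] := GP _ Aa.
  by apply: map_f; move: Aa; rewrite Al.
- move=> f A B f0 fS fA fB.
  have f1 n : (f n).1 = n.
    by elim: n => [|n IH]; rewrite ?f0//; have [-> _ _] := fS n; rewrite IH.
  suff sub A' B' : (forall n, V (f n) A') -> (forall n, V (f n) B') ->
      sval A' `<=` sval B'.
    by apply: finsub_eq; apply/seteqP; split; apply: sub.
  move=> {}fA {}fB a Aa.
  have /choice[U UP] n : exists U, U \in (f n).2 /\ U a.
    by have [_ _ [/(_ _ Aa)[U]]] := fA n; exists U.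
  (* The member at level [n] that includes [U n.+1] contains [a], hence is [U n]. *)
  have US n : U n.+1 `<=` U n.
    have [_ /(_ _ (UP n.+1).1)[_ [P Ps UP']] _] := fS n.
    have [_ d _] := fA n.
    have [[Us Ua] [_ Ua1]] := (UP n, UP n.+1).
    have <- : P = U n by apply: d Ps Us _ Ua; apply: UP'.
    exact: UP'.
  have [|b Bb Ub] := finite_nonincr_meets (svalP B').1 US.
    by move=> n; have [_ _ [_]] := fB n; apply; have [] := UP n.
  (* The shift skips the root: members at level [n.+1] come from [Bs n]. *)
  have UE : \bigcap_n U n.+1 = [set a].
    apply: Bsep => // n; last by have [] := UP n.+1.
    by have [_ /(_ _ (UP n.+1).1)[+ _] _] := fS n; rewrite f1.
  by have <- : b = a by have : (\bigcap_n U n.+1) b; [move=> n _; apply: Ub | rewrite UE].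
Qed.

End Vietoris.

Theorem theorem4p2 (X : topologicalType) :
  hausdorff_space X -> regular_space X ->
  (Wdelta_diagonal (@open X) <-> Wdelta_diagonal (vietoris_open X)).
Proof.
move=> hX _; split=> [XW|FW].
  by apply: Wdelta_of_sieve; [exact: vietoris_openI | exact: vietoris_sieve].
apply: Wdelta_of_sieve; first exact: openI.
apply: has_sieve_preimage (@finsub1_inj X) (@finsub1_preimage_open X) _.
by apply: sieve_of_Wdelta FW; apply: vietoris_openT.
Qed.
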